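(* Let $d\in\mathbb{Z}^n$ be nonincreasing with $\sum_{i\le n}d_i=0$. The following are equivalent: (1) $d$ is an imbalance sequence; (2) $\sum_{i\le k}d_i\le k(n-k)$ for all $k\in\{1,\dots,n\}$; (3) $\sum_{i\le k}d_i\le k(n-k)$ for all $k\in\{1,\dots,n-1\}$ such that $d_k-d_{k+1}\ge3$.
   Context: A sequence $d\in\mathbb{Z}^n$ is an imbalance sequence if there exists a simple directed graph (no loops, no multiple edges) on vertices $1,\dots,n$, with out-degrees $a_1,\dots,a_n$ and in-degrees $b_1,\dots,b_n$, such that $d_i=a_i-b_i$ for all $i$. *)

(* Defs.v *)
From mathcomp Require Import all_boot all_order all_algebra.
Set Implicit Arguments.
Unset Strict Implicit.
Unset Printing Implicit Defensive.
Import Order.TTheory GRing.Theory Num.Theory.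
Local Open Scope ring_scope.

(* A simple directed graph on a finite vertex set is an irreflexive relation:
   [e i j] holds when there is an edge from i to j. Antiparallel edges
   i -> j and j -> i are distinct edges, hence not multiple ones. *)

Definition outdeg (T : finType) (e : rel T) (i : T) : nat := #|[set j | e i j]|.

Definition indeg (T : finType) (e : rel T) (i : T) : nat := #|[set j | e j i]|.

Definition imbalance_sequence (n : nat) (d : n.-tuple int) : Prop :=
  exists2 e : rel 'I_n, irreflexive e &
    forall i : 'I_n, tnth d i = (outdeg e i)%:Z - (indeg e i)%:Z.

(* Main.v *)
(** Cancelling antiparallel edges, a digraph is a skew-symmetric matrix x with
entries in {-1, 0, 1}, and imbalances are row sums.  Summing rows over a set A
leaves only the entries from A to its complement, whence (2).  Conversely, start
from any such x and call (u, v) residual when x u v <= 0; raising x by 1 along a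
residual path from i to j moves one unit of row sum from j to i.  If some i has
too small a row sum and no vertex with too large a row sum is reachable from i,
then the reachable set A sends entries 1 to its complement, and the sum of d over
A exceeds #|A| * (n - #|A|), contradicting (2).  Finally, with
f k = k * (n - k) - (d_1 + ... + d_k), the second difference of f at k is
d_k - d_(k+1) - 2, so under (3) f is concave wherever it is negative; as it
vanishes at 0 and n, it is nonnegative: hence (3) implies (2). *)
Require Import Defs.
From mathcomp Require Import all_boot all_order all_algebra.
From mathcomp Require Import zify lra.
Set Implicit Arguments.
Unset Strict Implicit.
Unset Printing Implicit Defensive.
Import Order.TTheory GRing.Theory Num.Theory.
Local Open Scope ring_scope.

(** Skew symmetry turns the upper bound 1 into the lower bound -1, so only the former is
    recorded. *)
Definition skew_unit (T : finType) (x : T -> T -> int) : Prop :=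
  (forall i j, x j i = - x i j) /\ (forall i j, x i j <= 1).

Definition rowsum (T : finType) (x : T -> T -> int) (i : T) : int :=
  \sum_j x i j.

Lemma sum_rowsum_cut (T : finType) (x : T -> T -> int) (A : {set T}) :
  skew_unit x ->
  \sum_(i in A) rowsum x i = \sum_(i in A) \sum_(j in ~: A) x i j.
Proof.
move=> [skx _].
have inA0 : \sum_(i in A) \sum_(j in A) x i j = 0.
  have : \sum_(i in A) \sum_(j in A) x i j
         = - \sum_(i in A) \sum_(j in A) x i j.
    rewrite {1}exchange_big /= -sumrN; apply: eq_bigr => i _.
    by rewrite -sumrN; apply: eq_bigr => j _; apply: skx.
  lia.
rewrite -[RHS]add0r -[X in X + _]inA0 -big_split /=; apply: eq_bigr => i _.
rewrite /rowsum (bigID (mem A)) /=; congr (_ + _).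
by apply: eq_bigl => j; rewrite inE.
Qed.

Lemma sum_const_cut (T : finType) (A : {set T}) :
  \sum_(i in A) \sum_(j in ~: A) 1 = #|A|%:Z * (#|T|%:Z - #|A|%:Z).
Proof.
rewrite !sumr_const.
have := cardsC A; lia.
Qed.

Lemma sum_rowsum_le (T : finType) (x : T -> T -> int) (A : {set T}) :
  skew_unit x -> \sum_(i in A) rowsum x i <= #|A|%:Z * (#|T|%:Z - #|A|%:Z).
Proof.
move=> skx; rewrite sum_rowsum_cut // -sum_const_cut.
by apply: ler_sum => i _; apply: ler_sum => j _; apply: skx.2.
Qed.

Lemma sum_rowsum (T : finType) (x : T -> T -> int) :
  skew_unit x -> \sum_i rowsum x i = 0.
Proof.
move=> skx; have := sum_rowsum_cut [set: T] skx.
under eq_bigl do rewrite inE.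
move=> ->; apply: big1 => i _.
by apply: big1 => j; rewrite !inE.
Qed.

(** Induction along the path: its first arc moves one unit of row sum from [v] to [i], the rest
    moves it on from the last vertex to [v]. For empty [p] the two corrections cancel. *)
Lemma rowsum_augment (T : finType) (p : seq T) (x : T -> T -> int) (i : T) :
  skew_unit x -> path (fun u v => x u v <= 0) i p -> uniq (i :: p) ->
  exists2 y, skew_unit y &
    forall k, rowsum y k = rowsum x k + (k == i)%:Z - (k == last i p)%:Z.
Proof.
elim: p x i => [|v p IHp] x i skx /=.
  by move=> _ _; exists x => // k; rewrite addrK.
move=> /andP[xiv xp] /andP[iNvp uniq_vp].
have iNv : i != v by move: iNvp; rewrite inE negb_or => /andP[].
pose y a b : int :=
  x a b + ((a == i) && (b == v))%:Z - ((a == v) && (b == i))%:Z.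
have sky : skew_unit y.
  split=> a b; rewrite /y.
    rewrite skx.1 [(b == i) && _]andbC [(b == v) && _]andbC; lia.
  (* Only the entry at ([i], [v]) grows, and [x i v <= 0] leaves room for it. *)
  have [/andP[/eqP-> /eqP->]|_] := boolP ((a == i) && (b == v)).
    rewrite (negPf iNv) /=; lia.
  have := skx.2 a b; case: (_ && _); lia.
(* The rest of the path avoids [i], so [y] agrees with [x] along it. *)
have yp : path (fun u w => y u w <= 0) v p.
  move: xp iNvp; rewrite inE negb_or => xp /andP[_ iNp].
  have iNvp : i \notin v :: p by rewrite inE negb_or iNv.
  move: xp; apply: (@sub_in_path _ (fun w => w != i)).
    move=> a b /= /negPf ai /negPf bi; rewrite /y ai bi andbF /=; lia.
  apply/allP => w wvp; apply: contraNneq iNvp => <-; exact: wvp.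
have [z skz rz] := IHp y v sky yp uniq_vp.
exists z => // k; rewrite rz.
suff -> : rowsum y k = rowsum x k + (k == i)%:Z - (k == v)%:Z by lia.
rewrite /rowsum /y !big_split /= sumrN.
have delta (a b : T) : \sum_j ((k == a) && (j == b))%:Z = (k == a)%:Z.
  rewrite (bigD1 b) //= eqxx andbT big1 ?addr0 // => j /negPf->.
  by rewrite andbF.
by rewrite !delta.
Qed.

Lemma exists_skew_unit_rowsum (T : finType) (d : T -> int) :
  \sum_i d i = 0 ->
  (forall A : {set T},
     \sum_(i in A) d i <= #|A|%:Z * (#|T|%:Z - #|A|%:Z)) ->
  exists2 x, skew_unit x & forall i, rowsum x i = d i.
Proof.
move=> d0 dA.
(* Induction on the total deviation from [d], starting from the zero matrix. *)
suff main m (x : T -> T -> int) : skew_unit x ->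
    (\sum_i `|d i - rowsum x i|%N <= m)%N ->
    exists2 x, skew_unit x & forall i, rowsum x i = d i.
  by apply: (main _ (fun _ _ => 0) _ (leqnn _)); split.
elim: m x => [|m IHm] x skx le_m.
  exists x => // i; move: le_m; rewrite leqn0 sum_nat_eq0 => /forallP/(_ i) /=.
  lia.
have dx0 : \sum_i (d i - rowsum x i) = 0.
  by rewrite sumrB d0 sum_rowsum // subrr.
(* If no row sum is too small, the differences are nonpositive with sum 0, hence all vanish. *)
have [/forallP ge|] := boolP [forall i, d i <= rowsum x i].
  exists x => // i; apply/eqP; rewrite eq_le ge andbT -subr_ge0.
  rewrite -dx0 (bigD1 i) //= gerDl; apply: sumr_le0 => j _.
  by rewrite subr_le0.
rewrite negb_forall => /existsP[i]; rewrite -ltNge => lti.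
pose A := [set j | connect (fun u v => x u v <= 0) i j].
have [/forall_inP leA|] := boolP [forall j in A, rowsum x j <= d j].
  suff : \sum_(j in A) rowsum x j < \sum_(j in A) d j.
    rewrite ltNge; case/negP; apply: le_trans (dA A) _.
    rewrite sum_rowsum_cut // -sum_const_cut.
    apply: ler_sum => u uA; apply: ler_sum => v.
    rewrite inE => vNA; rewrite leNgt; apply: contra vNA => xuv.
    move: uA; rewrite !inE => iu; apply: connect_trans iu (connect1 _).
    lia.
  have iA : i \in A by rewrite inE connect0.
  rewrite (bigD1 i) //= [ltRHS](bigD1 i) //= ltr_leD //.
  by apply: ler_sum => j /andP[/leA].
rewrite negb_forall => /existsP[j]; rewrite negb_imply -ltNge inE.
case/andP=> /connectP[p xp ->] ltj.
(* Augmentation needs a path without repeated vertices. The deviation then drops at [i] and grows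
   nowhere, since the row sum is too large at the other end. *)
move: ltj; case/shortenP: xp => q xq uniq_q _ ltj.
have [y sky ry] := rowsum_augment skx xq uniq_q.
apply: (IHm y sky); rewrite -ltnS; apply: leq_trans le_m.
rewrite (bigD1 i) //= [in leqRHS](bigD1 i) //= -addSn leq_add //.
  rewrite ry eqxx; case: eqVneq => [iq|_]; last by lia.
  by move: ltj; rewrite -iq; lia.
apply: leq_sum => k /negPf ki; rewrite ry ki.
case: eqVneq => [->|_]; last by lia.
by move: (d _) (rowsum _ _) ltj => a b; lia.
Qed.

Lemma outdeg_sub_indeg (T : finType) (e : rel T) (i : T) :
  (outdeg e i)%:Z - (indeg e i)%:Z
  = rowsum (fun i j => (e i j)%:Z - (e j i)%:Z) i.
Proof.
have card (P : pred T) : #|[set j | P j]|%:Z = \sum_j (P j)%:Z.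
  rewrite -sum1_card big_mkcond /= -natz natr_sum.
  by apply: eq_bigr => j _; rewrite inE; case: (P j).
by rewrite /rowsum sumrB /outdeg /indeg !card.
Qed.

Lemma imbalance_sequenceE (n : nat) (d : n.-tuple int) :
  imbalance_sequence d <->
  exists2 x, skew_unit x & forall i, rowsum x i = tnth d i.
Proof.
split=> [[e irr_e de]|[x skx dx]].
  exists (fun i j => (e i j)%:Z - (e j i)%:Z).
    by split=> i j; lia.
  by move=> i; rewrite de outdeg_sub_indeg.
(* Entries -1 are the same edges read backwards, and entries 0 give no edge. *)
exists (fun i j => x i j == 1).
  by move=> i; have := skx.1 i i; lia.
move=> i; rewrite -dx outdeg_sub_indeg; apply: eq_bigr => j _.
have := skx.1 i j; have := skx.2 i j; have := skx.2 j i; lia.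
Qed.

Lemma sum_nth_prefix (n k : nat) (d : n.-tuple int) : (k <= n)%N ->
  \sum_(i < k) d`_i = \sum_(i in [set i : 'I_n | (i < k)%N]) tnth d i.
Proof.
move=> kn; rewrite (big_ord_widen _ (fun i => d`_i) kn).
by apply: eq_big => i; rewrite ?inE // (tnth_nth 0).
Qed.

Lemma card_prefix (n k : nat) : (k <= n)%N ->
  #|[set i : 'I_n | (i < k)%N]| = k.
Proof.
move=> kn; rewrite -sum1_card.
under eq_bigl do rewrite inE.
by rewrite -(big_ord_widen _ (fun=> 1%N) kn) sum1_card card_ord.
Qed.

(** Subtract a threshold [c] from every term: what remains is nonnegative on the prefix and
    nonpositive off it, so the prefix maximizes the sum. As both sets have the same size, [c]
    cancels. *)
Lemma sum_subset_le_prefix (n : nat) (d : n.-tuple int) (A : {set 'I_n}) :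
  (forall i j : 'I_n, (i <= j)%N -> tnth d j <= tnth d i) ->
  \sum_(i in A) tnth d i <= \sum_(i < #|A|) d`_i.
Proof.
move=> d_noninc; have An : (#|A| <= n)%N by rewrite -[leqRHS]card_ord max_card.
rewrite sum_nth_prefix //; have := card_prefix An.
set B := [set i : 'I_n | _] => cardB.
have [A0|/card_gt0P[i0 _]] := posnP #|A|.
  have -> : B = A by rewrite (cards0_eq A0); apply: cards0_eq; rewrite cardB.
  by [].
have [c cP] : exists c, forall i, if i \in B then c <= tnth d i
                                  else tnth d i <= c.
  have lt_n : (#|A|.-1 < n)%N by have := ltn_ord i0; lia.
  exists (tnth d (Ordinal lt_n)) => i; rewrite inE.
  case: ltnP => iA; apply: d_noninc => /=; last exact: leq_trans (leq_pred _) iA.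
  by rewrite -ltnS (ltn_predK iA).
suff : \sum_(i in A) (tnth d i - c) <= \sum_(i in B) (tnth d i - c).
  by rewrite !sumrB !sumr_const cardB lerD2r.
rewrite big_mkcond [leRHS]big_mkcond /=; apply: ler_sum => i _.
have := cP i; case: (i \in A); case: (i \in B); lia.
Qed.

(* Once f is negative and decreasing it stays so up to n. *)
Lemma ge0_of_concave_where_neg (f : nat -> int) (n : nat) :
  0 <= f 0%N -> 0 <= f n ->
  (forall k, (k.+1 < n)%N -> f k.+1 < 0 ->
     f k.+2 - f k.+1 <= f k.+1 - f k) ->
  forall k, (k <= n)%N -> 0 <= f k.
Proof.
move=> f0 fn concf; elim=> // k IHk ltkn; rewrite leNgt; apply/negP => fk.
have {}IHk := IHk (ltnW ltkn).
(* The descent starts with the step from [f k >= 0] to [f k.+1 < 0]. *)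
suff descent m : (k + m.+1 <= n)%N ->
    f (k + m.+1)%N < 0 /\ f (k + m.+1)%N < f (k + m)%N.
  have [] := descent (n - k.+1)%N; first by lia.
  have -> : (k + (n - k.+1).+1 = n)%N by lia.
  by rewrite ltNge fn.
elim: m => [|m IHm] le_n; first by rewrite addn1 addn0; lia.
have := concf (k + m)%N; move: IHm; rewrite !addnS; lia.
Qed.

(* Indices of a tuple start at 0, so d_k is d`_k.-1 and d_(k+1) is d`_k. *)
Theorem theorem3p9 (n : nat) (d : n.-tuple int)
    (d_noninc : forall i j : 'I_n, (i <= j)%N -> tnth d j <= tnth d i)
    (d_sum0 : \sum_(i < n) tnth d i = 0) :
  [<-> imbalance_sequence d;
       forall k : nat, (1 <= k <= n)%N ->
         \sum_(i < k) d`_i <= k%:Z * (n%:Z - k%:Z);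
       forall k : nat, (1 <= k <= n.-1)%N -> 3 <= d`_k.-1 - d`_k ->
         \sum_(i < k) d`_i <= k%:Z * (n%:Z - k%:Z)].

Proof.
tfae.
- move=> /imbalance_sequenceE[x skx dx] k /andP[_ kn].
  rewrite sum_nth_prefix // -(eq_bigr _ (fun i _ => dx i)).
  by have := sum_rowsum_le [set i : 'I_n | (i < k)%N] skx;
    rewrite card_prefix // card_ord.
- by move=> le2 k kn _; apply: le2; lia.
move=> le3; apply/imbalance_sequenceE.
pose f k : int := k%:Z * (n%:Z - k%:Z) - \sum_(i < k) d`_i.
have f_ge0 : forall k, (k <= n)%N -> 0 <= f k.
  apply: ge0_of_concave_where_neg.
  - by rewrite /f big_ord0; lia.
  - rewrite /f; under eq_bigr do rewrite -tnth_nth.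
    by rewrite d_sum0; lia.
  (* A gap of at least 3 contradicts [fk] by (3); otherwise the second difference, the gap minus 2,
     is nonpositive. *)
  move=> k ltkn fk; have [ge3|lt3] := leP 3 (d`_k - d`_k.+1).
    have kn : (1 <= k.+1 <= n.-1)%N by lia.
    by move: fk; rewrite /f subr_lt0 ltNge le3.
  have {}lt3 : d`_k - d`_k.+1 <= 2 by lia.
  rewrite /f !big_ord_recr /= (intS k.+1) (intS k); lra.
apply: exists_skew_unit_rowsum => // A.
apply: le_trans (sum_subset_le_prefix A d_noninc) _.
have := f_ge0 #|A|; rewrite /f subr_ge0 card_ord; apply.
by rewrite -[leqRHS]card_ord max_card.
Qed.
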